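(* Let $n, k$ be positive integers with $n \geq 200k$. Then the second player wins (i.e. has a winning strategy in) the $(k+1)$-star avoidance game on $K_n$.
   Context: For positive integers $n,k$, the $(k+1)$-star avoidance game on $K_n$ is the following two-player game of perfect information. The board is the edge set of the complete graph $K_n$ on $n$ vertices, and initially no edge is claimed. The players alternate turns, the first player starting; on each turn the player to move claims one previously unclaimed edge of $K_n$. The first player who has claimed all edges of some subgraph of $K_n$ isomorphic to the star $S_{k+1} = K_{1,k+1}$ loses, and the other player is declared the winner. Equivalently, each player must keep all degrees in the graph formed by their own edges at most $k$, and the first player to violate this loses. If all edges have been claimed and neither player has lost, the game is a draw. *)

(* Defs.v *)
From mathcomp Require Import all_boot.

Set Implicit Arguments.
Unset Strict Implicit.
Unset Printing Implicit Defensive.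

Definition complete_edges (n : nat) : {set {set 'I_n}} :=
  [set e : {set 'I_n} | #|e| == 2].

(* K_{1,m}, with centre ord0 and the m other vertices as leaves. *)
Definition star (m : nat) : rel 'I_m.+1 :=
  [rel x y | (x == ord0) != (y == ord0)].

Arguments star : clear implicits.

(* A need not induce H on the image of f: any subgraph of (the graph with edge
   set) A isomorphic to H counts. *)
Definition contains_copy (V : finType) (H : rel V) (n : nat)
    (A : {set {set 'I_n}}) : bool :=
  [exists f : {ffun V -> 'I_n},
    injectiveb f && [forall x, forall y, H x y ==> ([set f x; f y] \in A)]].

Definition player : Type := bool.
Definition player1 : player := false.
Definition player2 : player := true.

Section AvoidanceGame.

Variables (V : finType) (H : rel V) (n : nat).

(* The list of edges claimed so far, in chronological order. Moves are numbered
   from 0, so the first player makes the even-numbered ones. *)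
Definition history : Type := seq {set 'I_n}.

Definition to_move (h : history) : player := odd (size h).

Definition claimed (p : player) (h : history) : {set {set 'I_n}} :=
  [set e | (e \in h) && (odd (index e h) == p)].

Definition has_copy (p : player) (h : history) : bool :=
  contains_copy H (claimed p h).

Definition game_over (h : history) : bool :=
  [|| has_copy player1 h, has_copy player2 h
    | complete_edges n \subset h].

Definition legal_move (h : history) (e : {set 'I_n}) : bool :=
  (e \in complete_edges n) && (e \notin h).

Inductive reachable : history -> Prop :=
| reachable_start : reachable [::]
| reachable_move h e :
    reachable h -> ~~ game_over h -> legal_move h e -> reachable (rcons h e).

(* Play stops as soon as one player completes a copy of H, so in a reachable
   history at most one player has a copy, and that player has lost. *)
Definition wins (p : player) (h : history) : bool := has_copy (~~ p) h.

Definition is_strategy (p : player) (s : history -> {set 'I_n}) : Prop :=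
  forall h, reachable h -> ~~ game_over h -> to_move h = p ->
    legal_move h (s h).

Definition follows (p : player) (s : history -> {set 'I_n}) (h : history)
    : Prop :=
  forall i, i < size h -> to_move (take i h) = p ->
    nth set0 h i = s (take i h).

(* The board is finite, so every play reaches a history where the game is over. *)
Definition winning_strategy (p : player) (s : history -> {set 'I_n}) : Prop :=
  is_strategy p s /\
  forall h, reachable h -> game_over h -> follows p s h -> wins p h.

Definition has_winning_strategy (p : player) : Prop :=
  exists s : history -> {set 'I_n}, winning_strategy p s.

End AvoidanceGame.

Definition star_avoidance_win (k n : nat) (p : player) : Prop :=
  has_winning_strategy (star k.+1) n p.

(* Main.v *)
Require Import Defs.
From mathcomp Require Import all_boot zify.

Set Implicit Arguments.
Unset Strict Implicit.
Unset Printing Implicit Defensive.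

(* A player can make at most floor(kn/2) safe moves, so it is enough that the
   second player makes that many. He first keeps his degrees within one of each
   other, until they all are k or k - 1, with at least 198k - 1 vertices of degree
   k - 1. From then on let A, of size s, be his set of deficient vertices, and
   consider the graph induced on A by the edges claimed by either player. His
   own move uv removes the two vertices u, v from A, and the first player's reply
   adds at most one edge inside A. Taking u of largest degree and v of largest
   degree among the non-neighbours of u, he gets d(u) + d(v) >= 4e/s, whence the
   excess 2e - s decays at least as fast as s^2 and 2e <= s as soon as s <= 9.
   At s = 4 the free perfect matching of A is played in the right order: the
   total slack of the first player is then 2, so he cannot take both edges. *)

(** * Degrees and degree sums inside a vertex set *)

Section Degrees.

Variable T : finType.
Implicit Types (X : {set {set T}}) (A : {set T}) (u v w x y : T).

(** [X] may contain singletons, so the loop [[set v; v]] is excluded explicitly. *)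
Definition adj X v w : bool := (v != w) && ([set v; w] \in X).

Definition degin X A v : nat := #|[set w in A | adj X v w]|.

Definition degsum X A : nat := \sum_(v in A) degin X A v.

Lemma adjC X v w : adj X v w = adj X w v.
Proof. by rewrite /adj eq_sym setUC. Qed.

Lemma deginE X A v : degin X A v = \sum_(w in A) adj X v w.
Proof.
rewrite /degin -sum1_card big_mkcond [RHS]big_mkcond /=.
by apply: eq_bigr => w _; rewrite inE; case: (w \in A); case: adj.
Qed.

Lemma degin0 A v : degin set0 A v = 0.
Proof. by rewrite deginE big1 // => w _; rewrite /adj inE andbF. Qed.

Lemma eq_set2 v w x y : v != w ->
  ([set v; w] == [set x; y]) = (v == x) && (w == y) || (v == y) && (w == x).
Proof.
move=> vw; apply/eqP/idP => [E|]; last first.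
  by case/orP=> /andP[/eqP-> /eqP->] //; rewrite setUC.
have : v \in [set x; y] by rewrite -E set21.
have : w \in [set x; y] by rewrite -E set22.
rewrite !in_set2 => /orP[]/eqP wE /orP[]/eqP vE; move: vw.
all: by rewrite vE wE !eqxx ?orbT.
Qed.

Lemma adj_add X x y v w : x != y -> [set x; y] \notin X ->
  adj ([set x; y] |: X) v w
    = adj X v w + (v == x) * (w == y) + (v == y) * (w == x) :> nat.
Proof.
move=> xy nX; rewrite /adj; case: (eqVneq v w) => [<-|vw] /=.
  have : ~~ ((v == x) && (v == y)).
    by apply: contraNN xy => /andP[/eqP<- /eqP<-].
  by case: (v == x); case: (v == y).
have : ~~ [&& v == x, w == y & v == y].
  by apply: contraNN xy => /and3P[/eqP<- _ /eqP<-].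
have : ~~ ((v == x) && (w == y) || (v == y) && (w == x)) || ([set v; w] \notin X).
  by rewrite -eq_set2 // -implybE; apply/implyP => /eqP->.
rewrite in_setU1 (eq_set2 _ _ vw).
by case: (v == x); case: (w == y); case: (v == y); case: (w == x); case: (_ \in X).
Qed.

Lemma sum_delta A y : \sum_(w in A) (w == y) = (y \in A).
Proof.
case: (boolP (y \in A)) => yA.
  rewrite (bigD1 y) //= eqxx big1 // => w /andP[_ /negbTE->] //.
by rewrite big1 // => w wA; case: eqP => // wy; rewrite -wy wA in yA.
Qed.

Lemma degin_add X A x y v : x != y -> [set x; y] \notin X ->
  degin ([set x; y] |: X) A v
    = degin X A v + (v == x) * (y \in A) + (v == y) * (x \in A).
Proof.
move=> xy nX; rewrite !deginE -!sum_delta !big_distrr /= -!big_split /=.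
by apply: eq_bigr => w _; rewrite adj_add.
Qed.

Lemma degsum_add X A x y : x != y -> [set x; y] \notin X ->
  degsum ([set x; y] |: X) A = degsum X A + 2 * (x \in A) * (y \in A).
Proof.
move=> xy nX; rewrite /degsum.
under eq_bigr do rewrite degin_add //.
rewrite !big_split /= -!big_distrl /= !sum_delta; lia.
Qed.

Lemma sum_setD2 A u v (F : T -> nat) : u \in A -> v \in A -> u != v ->
  \sum_(w in A) F w = F u + F v + \sum_(w in A :\ u :\ v) F w.
Proof.
move=> uA vA uv; rewrite (big_setD1 u) //= (big_setD1 v) /= ?addnA //.
by rewrite !inE eq_sym uv.
Qed.

Lemma card_setD2 A u v : u \in A -> v \in A -> u != v ->
  #|A| = #|A :\ u :\ v| + 2.
Proof.
move=> uA vA uv.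
rewrite (cardsD1 u A) uA (cardsD1 v (A :\ u)) !inE vA eq_sym uv /=; lia.
Qed.

(** Each edge at [u] or [v] counts twice in the sum; as [u] and [v] are not adjacent, none is
    subtracted for both. *)
Lemma degsum_setD2 X A u v : u \in A -> v \in A -> u != v -> ~~ adj X u v ->
  degsum X (A :\ u :\ v) + 2 * (degin X A u + degin X A v) = degsum X A.
Proof.
move=> uA vA uv nuv; rewrite /degsum (sum_setD2 _ uA vA uv).
have D w : degin X A w = adj X w u + adj X w v + degin X (A :\ u :\ v) w.
  by rewrite !deginE (sum_setD2 _ uA vA uv).
under [in RHS]eq_bigr do rewrite D.
rewrite !big_split /=.
under [X in _ = _ + (X + _ + _)]eq_bigr do rewrite adjC.
under [X in _ = _ + (_ + X + _)]eq_bigr do rewrite adjC.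
rewrite -!deginE !D (adjC X v u) (negbTE nuv) /adj !eqxx /=; lia.
Qed.

Lemma degin_setD2 X A u v w : degin X (A :\ u :\ v) w <= degin X A w.
Proof.
by apply: subset_leq_card; apply/subsetP=> z; rewrite !inE => /andP[/and3P[_ _ ->]].
Qed.

Lemma double_degin_le X A u : u \in A -> 2 * degin X A u <= degsum X A.
Proof.
move=> uA; rewrite /degsum (big_setD1 u) //= mul2n -addnn leq_add2l.
rewrite {1}deginE (big_setD1 u) //= {1}/adj eqxx add0n.
apply: leq_sum => w; rewrite !inE => /andP[_ wA].
rewrite deginE (big_setD1 u) //= adjC; exact: leq_addr.
Qed.

Lemma degsum_le X A m : (forall w, w \in A -> degin X A w <= m) ->
  degsum X A <= #|A| * m.
Proof. by move=> le_m; rewrite -sum_nat_const; apply: leq_sum. Qed.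

Lemma markov_degin X A t :
  #|[set w in A | t <= degin X A w]| * t <= degsum X A.
Proof.
rewrite -sum_nat_const /degsum.
rewrite [X in _ <= X](big_setID [set w | t <= degin X A w]) /=.
apply: leq_trans (leq_addr _ _).
have -> : [set w in A | t <= degin X A w] = A :&: [set w | t <= degin X A w].
  by apply/setP=> w; rewrite !inE.
by apply: leq_sum => w; rewrite !inE => /andP[].
Qed.

(** Pigeonhole: [u] and its neighbours in [A] are too few to cover [S]. *)
Lemma degin_exists_nonadj X A u (S : {set T}) : S \subset A -> u \in S ->
  degin X A u + 1 < #|S| -> exists2 v, v \in S & (u != v) && ~~ adj X u v.
Proof.
move=> SA uS lt.
case: (pickP [pred v in S | (u != v) && ~~ adj X u v]) => [v /andP[vS Hv]|no].
  by exists v.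
suff: #|S| <= degin X A u + 1 by lia.
rewrite addn1 -[X in _ <= X](_ : #|u |: [set w in A | adj X u w]| = _); last first.
  by rewrite cardsU1 inE /adj eqxx andbF.
apply: subset_leq_card; apply/subsetP=> v vS; rewrite !inE (subsetP SA) //=.
by have := no v; rewrite /= vS /= eq_sym; case: (v == u) => //= /negbFE.
Qed.

(* [v] has the largest degree among the non-neighbours of [u]; all other
   vertices are [u] itself or its neighbours. *)
Lemma max_degin_pair X A :
    0 < #|A| -> (forall w, w \in A -> degin X A w + 1 < #|A|) ->
  exists u v,
    [/\ [/\ u \in A, v \in A, u != v & ~~ adj X u v],
        forall w, w \in A -> degin X A w <= degin X A u
      & degsum X A <= (degin X A u + 1) * degin X A u
                      + (#|A| - 1 - degin X A u) * degin X A v].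
Proof.
case/card_gt0P=> a aA nondom.
case: (arg_maxnP (degin X A) aA) => u uA umax.
have [v0 v0A /andP[uv0 nuv0]] := degin_exists_nonadj (subxx A) uA (nondom _ uA).
pose P := [pred v | [&& v \in A, u != v & ~~ adj X u v]].
have P0 : P v0 by rewrite /= v0A uv0.
case: (arg_maxnP (degin X A) P0) => v /and3P[vA uv nuv] vmax.
exists u, v; split=> //.
pose N := u |: [set w in A | adj X u w].
have NA : N \subset A.
  by apply/subsetP=> w; rewrite !inE => /orP[/eqP->|/andP[]].
have cN : #|N| = degin X A u + 1.
  by rewrite /N cardsU1 inE /adj eqxx andbF addnC.
rewrite /degsum (big_setID N) /= (setIidPr NA).
apply: leq_add.
  rewrite -cN -sum_nat_const; apply: leq_sum => w wN.
  exact/umax/(subsetP NA).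
have -> : #|A| - 1 - degin X A u = #|A :\: N| by rewrite cardsDS // cN; lia.
rewrite -sum_nat_const; apply: leq_sum => w; rewrite !inE negb_or => /andP[/andP[wu nw] wA].
by apply: vmax; rewrite /= wA eq_sym wu; rewrite wA in nw.
Qed.

End Degrees.

(** * Late stage: choice of the pair and decay of the excess *)

Section Late.

Variable T : finType.
Implicit Types (X : {set {set T}}) (A : {set T}) (u v w x y : T).

(* Box-game control of the degrees: removing a vertex of largest degree while the
   opponent adds an edge turns the bound for [j + 1] into the bound for [j].
   The instance [j = 0] says that no degree exceeds [#|A| / 2]. *)
Definition spread X A : bool :=
  [forall j : 'I_#|A|.+1, (8 * j <= #|A|) ==>
    (#|[set w in A | #|A| < 2 * degin X A w + 4 * j]| <= j)].

Lemma spreadP X A :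
  reflect (forall j, 8 * j <= #|A| ->
             #|[set w in A | #|A| < 2 * degin X A w + 4 * j]| <= j)
          (spread X A).
Proof.
apply: (iffP forallP) => H j; last by apply/implyP; apply: H.
move=> hj; have jA : j < #|A|.+1 by lia.
by have /implyP := H (Ordinal jA); apply.
Qed.

(* With e edges ([degsum] is 2e) and s vertices, the first bound reads
   2e - s <= s^2 / 99; a round multiplies 2e - s by at most 1 - 4 / s. For
   3 <= s <= 96 this bound alone excludes a vertex adjacent to all others. *)
Definition late X A : bool :=
  [&& 99 * degsum X A <= #|A| ^ 2 + 99 * #|A|,
      (#|A| == 2) ==> (degsum X A == 0)
    & (97 <= #|A|) ==> spread X A].

(** Here [s], [E], [D], [d] are the size of [A], its degree sum and the degrees of [u] and [v]. If
    [2 * (D + 1) > s], the bound on [99 * E] already gives [2 * E <= s * D]. *)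
Lemma degin_sum_arith s E D d : D + 1 < s -> E <= s * D ->
    E <= (D + 1) * D + (s - 1 - D) * d -> 3 < s -> 99 * E <= s ^ 2 + 99 * s ->
  2 * E <= s * (D + d).
Proof.
move=> Ds E1 E2 s4 E3.
have [small|big] := leqP (2 * (D + 1)) s; last first.
  have sD : s * (s - 1) <= 2 * (s * D) by nia.
  have [s5|s4'] := leqP 5 s; first by nia.
  have : 2 <= D by lia.
  have : s = 4 by lia.
  nia.
have [t st] : exists t, s = 2 * (D + 1) + t by exists (s - 2 * (D + 1)); lia.
have st1 : s - 1 - D = D + 1 + t by lia.
rewrite st1 in E2.
(* Weighted by [t] and [s], the two bounds add up to [2 * (D + 1 + t) * E <= s * (D + 1 + t) * (D +
   d)]. *)
have H1 := leq_mul (leqnn t) E1; have H2 := leq_mul (leqnn s) E2.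
rewrite -(@leq_pmul2l (D + 1 + t)); last by lia.
by subst s; clear -H1 H2; lia.
Qed.

Lemma late_pair X A : late X A -> 2 <= #|A| -> exists u v,
  [/\ [/\ u \in A, v \in A, u != v & ~~ adj X u v],
      forall w, w \in A -> degin X A w <= degin X A u
    & 4 <= #|A| -> 2 * degsum X A <= #|A| * (degin X A u + degin X A v)].
Proof.
case/and3P=> E3 E2 C s2.
(* A vertex adjacent to all others is excluded by [spread] at [j = 0] for 97 or more vertices, by
   the absence of edges for two, and in between because it would force
   [degsum X A >= 2 * (#|A| - 1)]. *)
have nondom w : w \in A -> degin X A w + 1 < #|A|.
  move=> wA; have [s97|s97] := leqP 97 #|A|.
    rewrite s97 in C; have /(_ 0 isT) := spreadP _ _ C.
    rewrite leqn0 cards_eq0 => /eqP/setP/(_ w); rewrite !inE wA /=; lia.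
  have := double_degin_le X wA; move: E2; case: eqP => /= [s_2 /eqP|s_2 _]; first lia.
  by move: (degin X A w) (degsum X A) E3 s2 s97 s_2 => d E; nia.
have [|u [v [H umax vsum]]] := max_degin_pair _ nondom; first lia.
exists u, v; split=> // s4; apply: degin_sum_arith => //.
- by case: H => uA _ _ _; apply: nondom.
- exact: degsum_le.
Qed.

Section LateStep.

Variables (X : {set {set T}}) (A : {set T}) (u v x y : T).
Hypotheses (uA : u \in A) (vA : v \in A) (uv : u != v).
Hypotheses (nuv : [set u; v] \notin X).
Hypotheses (xy : x != y) (nxy : [set x; y] \notin [set u; v] |: X).

Let X' := [set x; y] |: ([set u; v] |: X).
Let A' := A :\ u :\ v.

Lemma nadj_uv : ~~ adj X u v.
Proof. by rewrite /adj uv (negbTE nuv). Qed.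

Let cA : #|A| = #|A'| + 2.
Proof. exact: card_setD2. Qed.

Lemma degin_step w : degin X' A' w <= degin X A w + 1.
Proof.
have uA' : u \in A' = false by rewrite /A' !inE eqxx andbF.
have vA' : v \in A' = false by rewrite /A' !inE eqxx.
rewrite /X' degin_add // degin_add // uA' vA' !muln0 !addn0.
have := degin_setD2 X A u v w; rewrite -/A'.
have : (w == x) && (w == y) = false.
  by apply: contraNF xy => /andP[/eqP<- /eqP<-].
move: (degin X A' w) (degin X A w) => d d0.
by case: (w == x); case: (w == y) => //= _; clear; case: (x \in A'); case: (y \in A'); lia.
Qed.

Lemma degsum_step :
  degsum X' A' + 2 * (degin X A u + degin X A v) <= degsum X A + 2.
Proof.
rewrite /X' degsum_add // degsum_add // -(degsum_setD2 uA vA uv nadj_uv) -/A'.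
have -> : u \in A' = false by rewrite /A' !inE eqxx andbF.
by case: (x \in A'); case: (y \in A'); lia.
Qed.

Lemma spread_step : 97 <= #|A'| -> spread X A ->
    (forall w, w \in A -> degin X A w <= degin X A u) ->
    99 * degsum X' A' <= #|A'| ^ 2 + 99 * #|A'| ->
  spread X' A'.
Proof.
move=> s97 /spreadP C umax E'; apply/spreadP => j hj.
have [hj1|hj1] := leqP (8 * (j + 1)) #|A|.
  have := C _ hj1; set S := [set w in A | _]; set S' := [set w in A' | _].
  (* The size drops by 2 and [2 * degin] grows by at most 2; together this costs one unit of [j]. *)
  have sub : S' \subset S :\ u.
    apply/subsetP=> w; rewrite !inE => /andP[/and3P[wv wu wA]].
    rewrite wA wu /=; have := degin_step w; lia.
  case: (set_0Vmem S') => [->|[w wS']]; first by rewrite cards0.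
  have /setD1P[_] := subsetP sub _ wS'.
  rewrite inE => /andP[wA hw].
  have uS : u \in S by rewrite inE uA; have := umax _ wA; lia.
  have := subset_leq_card sub; rewrite (cardsD1 u S) uS; lia.
(* [j + 1] is out of range in the old position: count by Markov's inequality. *)
have := markov_degin X' A' ((#|A'| - 4 * j) ./2.+1).
set S1 := [set w in A' | _]; set S2 := [set w in A' | _].
have sub : S2 \subset S1.
  by apply/subsetP=> w; rewrite !inE => /andP[-> /=]; lia.
have := subset_leq_card sub.
have : #|A'| < 4 * (#|A'| - 4 * j)./2.+1 by lia.
have : #|A'| < 8 * j + 6 by lia.
move: E'; move: (degsum _ _) #|A'| #|S1| #|S2| s97 (_./2.+1).
move=> E s c1 c2 s97 h E' js hs c12 Eh.
(* Since [h > s / 4] and [j + 1 > s / 8], more than [j] vertices would force [E > s ^ 2 / 32], too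
   large for [s >= 97]. *)
rewrite leqNgt; apply/negP => jc.
have : (j + 1) * h <= E by nia.
nia.
Qed.

(** With [s] for [#|A|], [degsum_step] bounds the new excess by [1 - 4 / s] times the old one, and
    [s * (s - 4) <= (s - 2) ^ 2]. *)
Lemma late_step : late X A -> 5 <= #|A| ->
    (forall w, w \in A -> degin X A w <= degin X A u) ->
    2 * degsum X A <= #|A| * (degin X A u + degin X A v) ->
  late X' A'.
Proof.
case/and3P=> E3 E2 C s5 umax sum; have E' : 99 * degsum X' A' <= #|A'| ^ 2 + 99 * #|A'|.
  have := degsum_step; move: E3 sum s5; rewrite cA.
  move: (degsum X A) (degsum X' A') (_ + degin X A v) #|A'| => E E' d s.
  move=> E3 sum s5 step.
  rewrite -(@leq_pmul2l (s + 2)); last by lia.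
  nia.
apply/and3P; split=> //.
  by apply/implyP => /eqP s2; lia.
apply/implyP => s97; apply: spread_step => //.
by move/implyP: C; apply; lia.
Qed.

End LateStep.

(** * The last four deficient vertices, and entry into the late stage *)

Lemma degsum_eq0 X A :
  (forall v w, v \in A -> w \in A -> v != w -> [set v; w] \notin X) ->
  degsum X A = 0.
Proof.
move=> H; rewrite /degsum big1 // => v vA; rewrite deginE big1 // => w wA.
by rewrite /adj; case: eqVneq => //= vw; rewrite (negbTE (H _ _ _ _ vw)).
Qed.

Lemma degsum_eq0_notin X A v w : degsum X A = 0 -> v \in A -> w \in A ->
  v != w -> [set v; w] \notin X.
Proof.
move=> /eqP; rewrite sum_nat_eq0 => /forall_inP H vA wA vw.
have := H _ vA; rewrite deginE sum_nat_eq0 => /forall_inP/(_ _ wA).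
by rewrite /adj vw; case: (_ \in X).
Qed.

(** At four vertices the last hypothesis forces every edge inside [A] to meet [u] or [v]. *)
Lemma late4_split X A u v : late X A -> #|A| = 4 -> u \in A -> v \in A ->
    u != v -> ~~ adj X u v ->
    2 * degsum X A <= #|A| * (degin X A u + degin X A v) ->
  degsum X (A :\ u :\ v) = 0.
Proof.
move=> /and3P[E3 _ _] s4 uA vA uv nuv sum.
have := degsum_setD2 uA vA uv nuv; rewrite s4 in E3 sum; lia.
Qed.

(** The pair [A] stays free: [u] lies outside it, and the reply misses [z], which will be a vertex
    saturated by the first player. *)
Lemma late_card4 X A x y u v z : #|A| = 2 -> degsum X A = 0 ->
    u \notin A -> z \in A -> x != z -> y != z ->
  late ([set x; y] |: ([set u; v] |: X)) A.
Proof.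
move=> A2 E0 uA zA xz yz.
rewrite /late A2 /=.
suff -> : degsum ([set x; y] |: ([set u; v] |: X)) A = 0 by [].
apply: degsum_eq0 => a b aA bA ab; rewrite !in_setU1 !negb_or.
rewrite (degsum_eq0_notin E0) // andbT.
have zab : z \in [set a; b].
  have /eqP -> // : [set a; b] == A.
  by rewrite eqEcard cards2 ab A2 andbT; apply/subsetP => c /set2P[]->.
apply/andP; split; apply/negP => /eqP E; move: (zab); rewrite E.
  by rewrite !inE eq_sym (negbTE xz) eq_sym (negbTE yz).
have : u \in [set a; b] by rewrite E set21.
by move=> /set2P[]ua; move: uA; rewrite ua ?aA ?bA.
Qed.

(** Degrees are at most about [#|A| / 99], so small that every set counted in [spread] is empty. *)
Lemma late_init X A k :
    (forall w, w \in A -> degin X A w <= 2 * k) -> 198 * k <= #|A| + 1 ->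
    2 < #|A| ->
  late X A.
Proof.
move=> deg s s2; apply/and3P; split.
- by have := degsum_le deg; nia.
- by apply/implyP=> /eqP; lia.
apply/implyP => s97; apply/spreadP => j hj.
apply: leq_trans (leq0n _); rewrite leqn0 cards_eq0.
apply/eqP/setP => w; rewrite !inE; case: (boolP (w \in A)) => //= wA.
by have := deg _ wA; lia.
Qed.

End Late.

(** * One round of play, in the early and in the late stage *)

Section Step.

Variable T : finType.
Implicit Types (X R B : {set {set T}}) (A : {set T}) (u v w x y : T).

Definition deg X v := degin X [set: T] v.

Definition deficient k B : {set T} := [set v | deg B v < k].

(* The second player's degrees lie in [m - 1, m + 1]; the bound is [2k + 1]
   because a vertex has at most [2k] neighbours in the two graphs together. *)
Definition early k B m : bool :=
  [&& m < k, [forall v, (m <= deg B v + 1) && (deg B v <= m + 1)]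
    & #|[set v | deg B v == m + 1]|
      + minn #|[set v | deg B v + 1 == m]| (2 * k + 1) <= 2 * k + 1].

Definition late_stage k R B : bool :=
  [forall v, k <= deg B v + 1] && late (R :|: B) (deficient k B).

(** [R] and [B] are the graphs of the first and the second player, the latter to move; the degree
    sums say that [R] has one edge more. *)
Definition winning_position k R B : bool :=
  [&& [forall v, deg R v <= k], [forall v, deg B v <= k],
      degsum R [set: T] == degsum B [set: T] + 2
    & [exists m : 'I_k, early k B m] || late_stage k R B].

Lemma deg_add X x y v : x != y -> [set x; y] \notin X ->
  deg ([set x; y] |: X) v = deg X v + (v == x) + (v == y).
Proof. by move=> xy nX; rewrite /deg degin_add // !inE !muln1. Qed.

Lemma deg_add_saturated k X x y t : x != y -> [set x; y] \notin X ->
  deg ([set x; y] |: X) t <= k -> k <= deg X t -> x != t /\ y != t.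
Proof.
move=> xy nX; rewrite deg_add // (eq_sym x) (eq_sym y).
by case: (t == x); case: (t == y) => /= le ge; split=> //; lia.
Qed.

Lemma degin_setU R B A v : degin (R :|: B) A v <= deg R v + deg B v.
Proof.
rewrite /deg /degin; apply: leq_trans (leq_card_setU _ _).1; apply: subset_leq_card.
apply/subsetP=> w; rewrite !inE /adj in_setU => /and3P[_ ->].
by case/orP=> ->; rewrite ?orbT.
Qed.

(** Each deficient vertex has degree exactly [k - 1], so their number is the total slack of the
    second player. *)
Lemma deficient_card k B : (forall v, k <= deg B v + 1) ->
    (forall v, deg B v <= k) ->
  #|deficient k B| + degsum B [set: T] = #|T| * k.
Proof.
move=> lo hi; rewrite -sum1dep_card big_mkcond /= /degsum.
rewrite [X in _ + X](eq_bigl xpredT); last by move=> v; rewrite inE.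
rewrite -big_split /= -sum_nat_const; apply: eq_bigr => v _.
have := lo v; have := hi v; rewrite /deg; case: ifP => /=; lia.
Qed.

Lemma deficient_add k B u v : (forall v, k <= deg B v + 1) ->
    u \in deficient k B -> v \in deficient k B -> u != v ->
    [set u; v] \notin B ->
  deficient k ([set u; v] |: B) = deficient k B :\ u :\ v.
Proof.
move=> lo; rewrite !inE => ud vd uv nB; apply/setP => w.
rewrite !inE deg_add //; have := lo w.
by case: (w == u); case: (w == v) => /=; lia.
Qed.

Lemma degsum_slack k R A : (forall v, deg R v <= k) ->
    (forall v, v \in A -> deg R v < k) ->
  #|A| + degsum R [set: T] <= #|T| * k.
Proof.
move=> hi lt; rewrite -sum1_card big_mkcond /= /degsum.
rewrite [X in _ + X](eq_bigl xpredT); last by move=> v; rewrite inE.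
rewrite -big_split /= -sum_nat_const; apply: leq_sum => v _.
have := hi v; have := lt v; rewrite /deg; case: ifP => //= _; lia.
Qed.

Lemma late_move k R B : (forall v, deg R v <= k) -> (forall v, deg B v <= k) ->
    degsum R [set: T] = degsum B [set: T] + 2 ->
    (forall v, k <= deg B v + 1) -> late (R :|: B) (deficient k B) ->
  exists u v,
    [/\ u \in deficient k B, v \in deficient k B, u != v,
        [set u; v] \notin R :|: B
      & forall x y, x != y -> [set x; y] \notin [set u; v] |: (R :|: B) ->
          (forall w, deg ([set x; y] |: R) w <= k) ->
          late ([set x; y] |: ([set u; v] |: (R :|: B)))
               (deficient k B :\ u :\ v)].
Proof.
move=> Rk Bk RB lo L.
have cA := deficient_card lo Bk.
(* By [cA] and [RB] the first player's total slack is two less than the number of deficient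
   vertices; it is nonnegative, so there are at least two. *)
have R0 : #|[set: T] :&: set0| + degsum R [set: T] <= #|T| * k.
  by apply: degsum_slack => // v; rewrite !inE.
rewrite setI0 cards0 in R0.
have s2 : 2 <= #|deficient k B| by lia.
have [u [v [[uA vA uv nuv] umax sum]]] := late_pair L s2.
have nX : [set u; v] \notin R :|: B by move: nuv; rewrite /adj uv.
have [s5|s5] := leqP 5 #|deficient k B|.
  exists u, v; split=> // x y xy nxy _; apply: late_step => //.
  exact/sum/ltnW.
have [s4|s4] := leqP 4 #|deficient k B|; last first.
  (* The total slack of the first player is [s - 2 < 2]: no reply is safe. *)
  exists u, v; split=> // x y xy nxy safe.
  have nR : [set x; y] \notin R.
    by move: nxy; rewrite !inE !negb_or => /and3P[].
  have : #|[set: T] :&: set0| + degsum ([set x; y] |: R) [set: T] <= #|T| * k.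
    by apply: degsum_slack => // w; rewrite !inE.
  rewrite degsum_add // !inE setI0 cards0; clear -cA RB s4; lia.
have {s2 s4 s5} s4 : #|deficient k B| = 4 by lia.
set A := deficient k B in uA vA umax sum s4 cA L *.
have E0 : degsum (R :|: B) (A :\ u :\ v) = 0.
  by apply: late4_split => //; apply: sum; rewrite s4.
have A'2 : #|A :\ u :\ v| = 2. have := card_setD2 uA vA uv. lia.
have unA' : u \notin A :\ u :\ v by rewrite !inE eqxx andbF.
have vnA' : v \notin A :\ u :\ v by rewrite !inE eqxx.
(* [u v] and the complementary pair are both free and the total slack of the
   first player is 2, so one of the two pairs has an endpoint he has saturated:
   that pair is kept for the last move. *)
case: (pickP [pred t in A :\ u :\ v | k <= deg R t]) => [t /andP[tA' tk]|no].
  exists u, v; split=> // x y xy nxy safe.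
  have nR : [set x; y] \notin R.
    by move: nxy; rewrite !inE !negb_or => /and3P[].
  have [xt yt] := deg_add_saturated xy nR (safe t) tk.
  exact: (@late_card4 _ _ _ _ _ _ _ t).
have /eqP/cards2P[z [w [zw A'E]]] := A'2.
have zA' : z \in A :\ u :\ v by rewrite A'E set21.
have wA' : w \in A :\ u :\ v by rewrite A'E set22.
have [zA wA] : z \in A /\ w \in A.
  by move: zA' wA'; rewrite !inE => /and3P[_ _ ->] /and3P[_ _ ->].
have nzw := degsum_eq0_notin E0 zA' wA' zw.
have A2E : A :\ z :\ w = [set u; v].
  apply/eqP; rewrite eq_sym eqEcard cards2 uv.
  have := card_setD2 zA wA zw; rewrite s4 => sz.
  apply/andP; split; last by clear -sz; lia.
  move: zA' wA' uA vA; rewrite !inE => /and3P[zv zu _] /and3P[wv wu _] uA' vA'.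
  apply/subsetP => t; rewrite !inE => /orP[]/eqP->.
    by rewrite eq_sym wu eq_sym zu.
  by rewrite eq_sym wv eq_sym zv.
exists z, w; split=> // x y xy nxy safe.
have nR : [set x; y] \notin R.
  by move: nxy; rewrite !inE !negb_or => /and3P[].
have [t tuv tk] : exists2 t, t \in [set u; v] & k <= deg R t.
  case: (pickP [pred t in [set u; v] | k <= deg R t]) => [t /andP[tA' tk]|no'].
    by exists t.
  (* Otherwise all four vertices of [A] are unsaturated, against a slack of 2. *)
  suff: #|A| + degsum R [set: T] <= #|T| * k by clear -s4 cA RB; lia.
  apply: degsum_slack => // t tA.
  have := no t; have := no' t; rewrite /= !in_setD1 in_set2 tA andbT ltnNge.
  by case: (t == u); case: (t == v); case: (k <= _).
have [xt yt] := deg_add_saturated xy nR (safe t) tk.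
rewrite A2E; apply: (@late_card4 _ _ _ _ _ _ _ t) => //.
- by rewrite cards2 uv.
- apply: degsum_eq0 => a b /set2P[]-> /set2P[]->; rewrite ?eqxx // => _.
  by rewrite setUC.
- by rewrite -A2E !inE eqxx andbF.
Qed.

(** All degrees are now [m] or [m + 1]. Either the level rises, with an empty upper class, or
    [m + 1 = k] and at most [2 * k + 1] vertices are not deficient. *)
Lemma early_end k R B m : 0 < k -> 200 * k <= #|T| ->
    (forall v, deg R v <= k) -> (forall v, deg B v <= k) ->
    early k B m -> #|[set v | deg B v + 1 == m]| = 0 ->
  early k B m.+1 || late_stage k R B.
Proof.
move=> k0 hT Rk Bk /and3P[mk /forallP lo cnt] p0.
have lo' v : m <= deg B v.
  have /andP[h _] := lo v.
  have : v \notin [set v | deg B v + 1 == m] by rewrite (cards0_eq p0) inE.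
  by rewrite inE; lia.
have [mk'|mk'] := ltnP m.+1 k.
  apply/orP; left; apply/and3P; split=> //.
    by apply/forallP=> v; have := lo' v; have := lo v; lia.
  rewrite (_ : [set v | deg B v == m.+1 + 1] = set0) ?cards0; last first.
    by apply/setP => v; rewrite !inE; have := lo v; lia.
  by rewrite add0n geq_minr.
apply/orP; right; apply/andP; split.
  by apply/forallP => v; have := lo' v; lia.
rewrite p0 min0n addn0 in cnt.
have defE : deficient k B = ~: [set v | deg B v == m + 1].
  by apply/setP => v; rewrite !inE; have := lo v; lia.
have := cardsC [set v | deg B v == m + 1]; rewrite -defE => cT.
apply: (@late_init _ _ _ k); try lia.
by move=> w _; have := degin_setU R B (deficient k B) w;
  have := Rk w; have := Bk w; lia.
Qed.

(** The level is raised while its lower class is empty; this ends because [m < k]. *)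
Lemma early_start k R B m : 0 < k -> 200 * k <= #|T| ->
    (forall v, deg R v <= k) -> (forall v, deg B v <= k) -> early k B m ->
  late_stage k R B
    \/ exists2 m, early k B m & 0 < #|[set v | deg B v + 1 == m]|.
Proof.
move=> k0 hT Rk Bk; have [n] := ubnP (k - m).
elim: n m => // n IHn m lekm Em; have [p0|p0] := posnP #|[set v | deg B v + 1 == m]|.
  have /orP[E|] := early_end k0 hT Rk Bk Em p0; last by left.
  by apply: IHn E; have /and3P[? _ _] := Em; lia.
by right; exists m.
Qed.

Lemma early_move k R B m : 200 * k <= #|T| ->
    (forall v, deg R v <= k) -> (forall v, deg B v <= k) ->
    early k B m -> 0 < #|[set v | deg B v + 1 == m]| ->
  exists u v, [/\ u != v, [set u; v] \notin R :|: B, deg B u < k, deg B v < k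
                & early k ([set u; v] |: B) m].
Proof.
move=> hT Rk Bk /and3P[mk /forallP lo cnt] /card_gt0P[u uP].
set P := [set v | deg B v + 1 == m] in uP cnt.
set Q := [set v | deg B v == m + 1] in cnt.
have ud : degin (R :|: B) [set: T] u <= 2 * k.
  by have := degin_setU R B [set: T] u; have := Rk u; have := Bk u; lia.
have [v [uv nX vm vP]] : exists v, [/\ u != v, [set u; v] \notin R :|: B,
    deg B v <= m & (2 * k + 1 < #|P|) ==> (v \in P)].
  (* Since [u] has at most [2 * k] neighbours, a large [P] contains a free partner; otherwise the
     complement of [Q], which is large, does. *)
  have [big|small] := ltnP (2 * k + 1) #|P|.
    have := @degin_exists_nonadj _ (R :|: B) [set: T] u P (subsetT _) uP.
    case; first lia.
    move=> v vP /andP[uv]; rewrite /adj uv /= => nX; exists v; split=> //.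
    by move: vP; rewrite inE; lia.
  have := @degin_exists_nonadj _ (R :|: B) [set: T] u (~: Q) (subsetT _).
  case; first by move: uP; rewrite !inE; lia.
    by have := cardsC Q; lia.
  move=> v vP /andP[uv]; rewrite /adj uv /= => nX; exists v; split=> //.
  by move: vP; rewrite !inE; have := lo v; lia.
have uP' : deg B u + 1 = m by move: uP; rewrite inE => /eqP.
exists u, v; split=> //; try lia.
have nB : [set u; v] \notin B by apply: contra nX; rewrite in_setU orbC => ->.
apply/and3P; split=> //.
  apply/forallP => w; rewrite deg_add //; have := lo w.
  have wuv : ~~ ((w == u) && (w == v)).
    by apply: contraNN uv => /andP[/eqP<- /eqP<-].
  case: (eqVneq w u) wuv => [->|_] /=; last by case: (eqVneq w v) => [->|_] /=; lia.
  by move/negbTE->; lia.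
set Q' := [set v | _]; set P' := [set v | _].
have sP : P' \subset P :\ u.
  apply/subsetP=> w; rewrite !inE deg_add //; have := lo w.
  by case: (eqVneq w u) => [->|_]; case: (_ == v) => /=; lia.
have := subset_leq_card sP; have := cardsD1 u P; rewrite uP /= => cP cP'.
have [vinP|vnP] := boolP (v \in P).
  have sQ : Q' \subset Q.
    apply/subsetP=> w; rewrite !inE deg_add //; move: vinP uv; rewrite inE.
    case: (eqVneq w u) => [->|_]; last by case: (eqVneq w v) => [->|_] /=; lia.
    by move=> _ /negbTE-> /=; lia.
  by have := subset_leq_card sQ; lia.
(* [v] may join the upper class, but here [#|P| <= 2 * k + 1], so the loss of [u] from [P] makes up
   for it. *)
have sQ : Q' \subset v |: Q.
  apply/subsetP=> w; rewrite !inE deg_add //.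
  case: (eqVneq w v) => [->|_] //=.
  by case: (eqVneq w u) => [->|_] /=; lia.
have := subset_leq_card sQ; rewrite cardsU1.
move: vP; rewrite (negbTE vnP) implybF; have := leq_b1 (v \notin Q); lia.
Qed.

(** Only safe replies need be answered: any other reply loses at once. *)
Lemma winning_position_step k R B : 0 < k -> 200 * k <= #|T| -> winning_position k R B ->
  exists u v, [/\ u != v, [set u; v] \notin R :|: B,
      forall w, deg ([set u; v] |: B) w <= k
    & forall x y, x != y -> [set x; y] \notin [set u; v] |: (R :|: B) ->
        (forall w, deg ([set x; y] |: R) w <= k) ->
        winning_position k ([set x; y] |: R) ([set u; v] |: B)].
Proof.
move=> k0 hT /and4P[/forallP Rk /forallP Bk /eqP RB stage].
have notin x y (X Y : {set {set T}}) : [set x; y] \notin X :|: Y ->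
    [set x; y] \notin X /\ [set x; y] \notin Y.
  by rewrite in_setU negb_or => /andP.
have add_le u v : u != v -> [set u; v] \notin B -> deg B u < k -> deg B v < k ->
    forall w, deg ([set u; v] |: B) w <= k.
  move=> uv nB uk vk w; rewrite deg_add //; have := Bk w.
  case: (eqVneq w u) => [->|_]; last by case: (eqVneq w v) => [->|_] /=; lia.
  by rewrite (negbTE uv); lia.
have sum x y u v : x != y -> u != v -> [set x; y] \notin R ->
    [set u; v] \notin B ->
    degsum ([set x; y] |: R) [set: T] == degsum ([set u; v] |: B) [set: T] + 2.
  by move=> xy uv nR nB; rewrite !degsum_add // !inE RB; lia.
have {stage} [/andP[/forallP lo L]|[m Em p0]] : late_stage k R B
    \/ exists2 m, early k B m & 0 < #|[set v | deg B v + 1 == m]|.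
  case/orP: stage => [/existsP[m Em]|]; last by left.
  exact: early_start Em.
  have [u [v [uA vA uv nX H]]] := late_move Rk Bk RB lo L.
  have [nR nB] := notin _ _ _ _ nX.
  have Bk' : forall w, deg ([set u; v] |: B) w <= k.
    by apply: add_le => //; move: uA vA; rewrite !inE.
  exists u, v; split=> // x y xy nxy safe.
  have [_ /notin[nR' _]] := notin _ _ _ _ nxy.
  apply/and4P; split; [exact/forallP|exact/forallP|exact: sum|].
  apply/orP; right; apply/andP; split.
    apply/forallP=> w; apply: leq_trans (lo w) _.
    by rewrite deg_add // leq_add2r -addnA leq_addr.
  rewrite deficient_add // -setUA [R :|: _]setUCA.
  exact: H.
have [u [v [uv nX uk vk E]]] := early_move hT Rk Bk Em p0.
have [nR nB] := notin _ _ _ _ nX.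
have Bk' := add_le _ _ uv nB uk vk.
exists u, v; split=> // x y xy nxy safe.
have [_ /notin[nR' _]] := notin _ _ _ _ nxy.
apply/and4P; split; [exact/forallP|exact/forallP|exact: sum|].
apply/orP; left; apply/existsP.
by have /and3P[mk _ _] := E; exists (Ordinal mk).
Qed.

End Step.

Lemma contains_star n k (A : {set {set 'I_n}}) :
  contains_copy (star k.+1) A = [exists v, k < deg A v].
Proof.
apply/existsP/existsP => [[f /andP[/injectiveP finj /forallP H]]|[v kv]].
  exists (f ord0).
  have kE : #|f @: [set~ ord0]| = k.+1 by rewrite card_imset // cardsC1 card_ord.
  apply: (leq_trans (eq_leq (esym kE))); apply: subset_leq_card; apply/subsetP => _ /imsetP[i i0 ->].
  rewrite !inE /= in i0 *; rewrite /adj (inj_eq finj) eq_sym i0 /=.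
  by have /forallP/(_ i)/implyP := H ord0; apply; rewrite /star /= eqxx (negbTE i0).
pose N := [set w in [set: 'I_n] | adj A v w].
have lt (i : 'I_k.+1) : i < #|N| by apply: leq_trans kv.
(* The leaves are the first [k + 1] neighbours of [v] in the enumeration of [N]. *)
pose g (i : 'I_k.+1) := enum_val (Ordinal (lt i)).
have gN i : g i \in N by exact: enum_valP.
have ginj : injective g.
  by move=> i j /enum_val_inj[] /ord_inj.
pose f : {ffun 'I_k.+2 -> 'I_n} := [ffun i : 'I_k.+2 => 
  if unlift ord0 i is Some j then g j else v].
have f0 : f ord0 = v by rewrite ffunE unlift_none.
have fS i : f (lift ord0 i) = g i by rewrite ffunE liftK.
exists f; apply/andP; split.
  apply/injectiveP => i j.
  case: (unliftP ord0 i) => [i' ->|->]; case: (unliftP ord0 j) => [j' ->|->];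
    rewrite ?f0 ?fS //.
  - by move/ginj->.
  - by move=> gv; have := gN i'; rewrite inE /adj gv eqxx andbF.
  - by move=> gv; have := gN j'; rewrite inE /adj -gv eqxx andbF.
apply/forallP=> i; apply/forallP=> j; apply/implyP; rewrite /star /=.
case: (unliftP ord0 i) => [i' ->|->]; case: (unliftP ord0 j) => [j' ->|->] //= _;
  rewrite f0 fS ?(setUC [set g _]).
- by have := gN i'; rewrite inE /adj => /and3P[_ _].
- by have := gN j'; rewrite inE /adj => /and3P[_ _].
Qed.

(** * The strategy and its invariant along a play *)

Section Play.

Variables n k : nat.
Implicit Types (h : history n) (e : {set 'I_n}) (p : player).

Notation has_star := (has_copy (star k.+1)).

Lemma has_starPn p h :
  reflect (forall v, deg (claimed p h) v <= k) (~~ has_star p h).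
Proof.
rewrite /has_copy contains_star negb_exists; apply: (iffP forallP) => H v.
  by rewrite leqNgt; apply: H.
by rewrite -leqNgt; apply: H.
Qed.

(** Appending a new edge leaves the earlier indices unchanged and gives it index [size h], whose
    parity names its owner. *)
Lemma claimed_rcons p h e : e \notin h -> claimed p (rcons h e) =
  if odd (size h) == p then e |: claimed p h else claimed p h.
Proof.
move=> eh; apply/setP => e'; rewrite !inE mem_rcons inE -cats1 index_cat.
case: (eqVneq e' e) => [->|ne] /=.
  by rewrite (negbTE eh) /= eqxx addn0; case: ifP => /= H; rewrite !inE ?eqxx ?(negbTE eh).
case: (boolP (e' \in h)) => e'h /=; case: ifP => _; rewrite !inE ?(negbTE ne) ?e'h //=.
  by rewrite (negbTE e'h).
by rewrite (negbTE e'h).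
Qed.

Lemma mem_claimed h e : (e \in claimed player1 h :|: claimed player2 h) = (e \in h).
Proof. by rewrite !inE -andb_orr /player1 /player2; case: odd; rewrite andbT. Qed.

Lemma legal_moveP h e : reflect
  (exists x y, [/\ e = [set x; y], x != y & [set x; y] \notin h]) (legal_move h e).
Proof.
rewrite /legal_move inE; apply: (iffP andP) => [[/cards2P[x [y [xy ->]]] H]|].
  by exists x, y.
by case=> x [y [-> xy H]]; rewrite cards2 xy.
Qed.

Definition holds h := winning_position k (claimed player1 h) (claimed player2 h).

(** The counterpart of [holds] when the first player is to move. *)
Definition secure h : bool :=
  [forall e, legal_move h e && ~~ has_star player1 (rcons h e) ==> holds (rcons h e)].

Definition good h e : bool :=
  [&& legal_move h e, ~~ has_star player2 (rcons h e) & secure (rcons h e)].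

(** A strategy must be legal in all unfinished positions, also off its own plays, hence the
    fallback; [set0] is returned only on a full board. *)
Definition strategy h : {set 'I_n} :=
  if [pick e | good h e] is Some e then e else odflt set0 [pick e | legal_move h e].

Lemma strategy_legal : is_strategy (star k.+1) player2 strategy.
Proof.
move=> h _ over _; rewrite /strategy; case: pickP => [e /and3P[]//|_].
case: pickP => //= no; case/negP: over; apply/or3P/Or33/subsetP => e ec.
by have := no e; rewrite /legal_move ec /= => /negbFE.
Qed.

Hypotheses (k0 : 0 < k) (kn : 200 * k <= n).

Lemma secure_nil : secure [::].
Proof.
apply/forallP=> e; apply/implyP => /andP[/legal_moveP[x [y [-> xy _]]]].
set h := rcons _ _ => /has_starPn Rk.
have B0 : claimed player2 h = set0.
  by rewrite /h claimed_rcons //=; apply/setP => e'; rewrite !inE.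
have R0 : claimed player1 h = [set x; y] |: set0.
  by rewrite /h claimed_rcons //=; congr (_ |: _); apply/setP => e'; rewrite !inE.
have d0 (v : 'I_n) : deg set0 v = 0 by exact: degin0.
rewrite /holds B0; apply/and4P; split.
- exact/forallP.
- by apply/forallP=> v; rewrite d0.
- by rewrite R0 degsum_add ?inE.
(* The second player has no edge yet, so play starts at level 0 with an empty upper class. *)
apply/orP; left; apply/existsP; exists (Ordinal k0).
apply/and3P; split=> //=.
  by apply/forallP=> v; rewrite d0.
rewrite (_ : [set v | deg set0 v == 0 + 1] = set0); last first.
  by apply/setP => v; rewrite !inE d0.
by rewrite cards0 add0n geq_minr.
Qed.

Lemma good_exists h : to_move h = player2 -> holds h -> exists e, good h e.
Proof.
rewrite /to_move => oh H.
have kT : 200 * k <= #|'I_n| by rewrite card_ord.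
have [u [v [uv nX Bk step]]] := winning_position_step k0 kT H.
rewrite mem_claimed in nX.
have c1 : claimed player1 (rcons h [set u; v]) = claimed player1 h.
  by rewrite claimed_rcons // oh.
have c2 : claimed player2 (rcons h [set u; v]) = [set u; v] |: claimed player2 h.
  by rewrite claimed_rcons // oh.
exists [set u; v]; apply/and3P; split.
- by apply/legal_moveP; exists u, v.
- by apply/has_starPn; rewrite c2.
apply/forallP => e; apply/implyP => /andP[/legal_moveP[x [y [-> xy nh]]]].
have R1 : claimed player1 (rcons (rcons h [set u; v]) [set x; y])
          = [set x; y] |: claimed player1 h.
  by rewrite claimed_rcons // size_rcons /= oh c1.
have B1 : claimed player2 (rcons (rcons h [set u; v]) [set x; y])
          = [set u; v] |: claimed player2 h.
  by rewrite claimed_rcons // size_rcons /= oh c2.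
move/has_starPn; rewrite /holds R1 B1 => Rk; apply: step => //.
by rewrite in_setU1 mem_claimed -in_cons -mem_rcons.
Qed.

(** Induction on the moves: [good_exists] handles the second player's moves, and [secure] by
    definition covers every reply. *)
Lemma play_invariant h :
    reachable (star k.+1) h -> follows player2 strategy h ->
  ~~ has_star player2 h /\
  (if to_move h then has_star player1 h || holds h else secure h).
Proof.
elim=> [_|{}h e _ IH over lm foll].
  split; last exact: secure_nil.
  apply/has_starPn => v.
  rewrite (_ : claimed _ _ = set0); last by apply/setP=> e; rewrite !inE.
  by rewrite /deg degin0.
have [] := IH.
  move=> i ih ti; have := foll i; rewrite size_rcons -cats1 nth_cat ih.
  by rewrite takel_cat 1?ltnW //; apply=> //; lia.
have /andP[_ eh] := lm.
rewrite /to_move size_rcons /=; case: (boolP (odd (size h))) => /= oh no2 H.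
  have no1 : ~~ has_star player1 h by apply: contraNN over => H1; rewrite /game_over H1.
  rewrite (negbTE no1) /= in H.
  have [e0 ge0] := good_exists oh H.
  have -> : e = strategy h.
    have := foll (size h); rewrite size_rcons nth_rcons ltnn eqxx -cats1.
    by rewrite take_size_cat //; apply.
  rewrite /strategy; case: pickP => [e1 /and3P[_ ? ?] //|no].
  by rewrite no in ge0.
split.
  by move: no2; rewrite /has_copy claimed_rcons // (negbTE oh).
have /implyP := forallP H e; rewrite lm /=; case: has_copy => //=; exact.
Qed.

(** No draw: on a full board a vertex has degree [n - 1], while two safe players give it at most
    [2 * k]. *)
Lemma full_board h : ~~ has_star player1 h -> ~~ has_star player2 h ->
  ~~ (complete_edges n \subset h).
Proof.
move=> /has_starPn Rk /has_starPn Bk; apply/negP => /subsetP full.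
have n0 : 0 < n by lia.
pose v := Ordinal n0.
have := degin_setU (claimed player1 h) (claimed player2 h) [set: 'I_n] v.
have -> : degin (claimed player1 h :|: claimed player2 h) [set: 'I_n] v = n.-1.
  rewrite /degin -[in RHS](card_ord n) -(cardsC1 v); apply: eq_card => w.
  rewrite !inE /adj mem_claimed eq_sym; case: eqVneq => //= vw.
  by apply: full; rewrite inE cards2 (eq_sym v) vw.
have := Rk v; have := Bk v; lia.
Qed.

End Play.

Theorem theorem1 (n k : nat) (hn : 0 < n) (hk : 0 < k) (hnk : 200 * k <= n) :
  star_avoidance_win k n player2.
Proof.
exists (@strategy n k); split; first exact: strategy_legal.
move=> h reach over foll.
have [no2 _] := play_invariant hk hnk reach foll.
rewrite /wins /=; have [//|no1] := boolP (has_copy _ player1 h).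
by move: over; rewrite /game_over (negbTE no1) (negbTE no2) (negbTE (full_board hk hnk no1 no2)).
Qed.
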